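(* Let $0\le a<b\le\infty$ and suppose that the heat kernel $p(t,x,y)$ of $X$ satisfies, for some $C>0$, $$p(t,x,y)\le\frac{C\,t}{V(d(x,y))\,\phi(d(x,y))}$$ for all $x\in M\setminus\mathscr N$, $\mu$-almost all $y\in M$ and all $t\in(a,b)$, where $\phi:(0,\infty)\to(0,\infty)$ is a strictly increasing function for which there are constants $c_3,c_4,d_3,d_4>0$ with $$c_3\Big(\frac Rr\Big)^{d_3}\le\frac{\phi(R)}{\phi(r)}\le c_4\Big(\frac Rr\Big)^{d_4}\quad\text{for all }0<r\le R.$$ Assume that the process $X$ is conservative. Then: (1) If $a=0$ and $\varphi:(0,1)\to(0,\infty)$ is an increasing function such that $\int_0^1\frac{1}{\phi(\varphi(t))}\,dt<\infty$, then for all $x\in M\setminus\mathscr N$, $\mathbf P^x$-a.s., $$\limsup_{t\to0}\frac{\sup_{0\le s\le t}d(X_s,x)}{\varphi(t)}=0.$$ (2) If $b=\infty$ and $\varphi:(1,\infty)\to(0,\infty)$ is an increasing function such that $\int_1^\infty\frac{1}{\phi(\varphi(t))}\,dt<\infty$, then for all $x\in M\setminus\mathscr N$, $\mathbf P^x$-a.s., $$\limsup_{t\to\infty}\frac{\sup_{0\le s\le t}d(X_s,x)}{\varphi(t)}=0.$$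
   Context: $(M,d)$ is a locally compact, separable, connected metric space in which every ball $B(x,r)=\{y:d(x,y)<r\}$ is relatively compact, and $\mu$ is a Radon measure on $M$ with full support such that $C_*^{-1}V(r)\le\mu(B(x,r))\le C_*V(r)$ for all $x\in M$, $r>0$, where $C_*\ge1$ and $V:(0,\infty)\to(0,\infty)$ is strictly increasing with $V(0)=0$, $V(\infty)=\infty$ and $V(2r)\le cV(r)$ for all $r>0$ (some $c>1$). $(\mathscr E,\mathscr F)$ is a symmetric regular Dirichlet form on $L^2(M,\mu)$ of pure-jump type: there is a symmetric Radon measure $n(\cdot,\cdot)$ on $M\times M\setminus\mathrm{diag}$ with $\mathscr E(u,v)=\int_{M\times M\setminus \mathrm{diag}}(u(x)-u(y))(v(x)-v(y))\,n(dx,dy)$ for $u,v\in\mathscr F\cap C_c(M)$. $X=(X_t,t\ge0;\mathbf P^x;\mathscr F_t)$ is the associated Hunt process, uniquely determined for starting points outside a properly exceptional set $\mathscr N\subset M$, with semigroup $(P_t)$. A heat kernel is a non-negative symmetric measurable function $p$ on $(0,\infty)\times M\times M$ with $P_tf(x)=\int p(t,x,z)f(z)\,\mu(dz)$ and $p(t+s,x,y)=\int p(t,x,z)p(s,z,y)\,\mu(dz)$ for all $s,t>0$, $x\in M\setminus\mathscr N$ and $\mu$-a.a. $y$. Conservative means $\int p(t,x,y)\,\mu(dy)=1$ for all $t>0$, $x\in M\setminus\mathscr N$ (infinite lifetime). *)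

(* Defs.v *)
From HB Require Import structures.
From mathcomp Require Import all_boot all_order all_algebra.
From mathcomp Require Import all_classical all_reals all_analysis.
From mathcomp Require Import measurable_realfun.

Set Implicit Arguments.
Unset Strict Implicit.
Unset Printing Implicit Defensive.

Import Order.TTheory GRing.Theory Num.Theory.
Import numFieldNormedType.Exports.

Local Open Scope classical_set_scope.
Local Open Scope ring_scope.

(* Base points are required by [g_sigma_algebraType]; they play no other role
   than making the space nonempty. *)
#[short(type="pmetricType")]
HB.structure Definition PMetric (K : numDomainType) :=
  { M of Metric K M & isPointed M }.

HB.instance Definition _ (T U : ptopologicalType) := Pointed.on (T * U)%type.

Notation borel T := (g_sigma_algebraType (@open T)).

(* Measures on the open subspace [D] of [T] are represented by Borel measures
   on [T], only the values at subsets of [D] being relevant. *)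
Definition radon_on (R : realType) (T : ptopologicalType) (D : set T)
    (nu : {measure set (borel T) -> \bar R}) : Prop :=
  (forall K : set T, compact K -> K `<=` D -> (nu K < +oo)%E) /\
  (forall A : set (borel T), measurable A -> A `<=` D ->
    nu A = ereal_sup [set nu K | K in [set K : set T | compact K /\ K `<=` A]]).

Section Space.
Context (R : realType) (M : pmetricType R).

Definition separable : Prop := exists D : set M, countable D /\ dense D.

Definition full_support (mu : {measure set (borel M) -> \bar R}) : Prop :=
  forall U : set M, open U -> U !=set0 -> (0 < mu U)%E.

(* [V] and [phi] below are functions on ]0, +oo[: their values elsewhere are
   irrelevant, and V(0), V(oo) denote limits. *)
Record volume_function (V : R -> R) : Prop := {
  volume_gt0 : forall r : R, 0 < r -> 0 < V r ;
  volume_increasing : forall r s : R, 0 < r -> r < s -> V r < V s ;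
  volume_at0 : V r @[r --> 0^'+] --> 0 ;
  volume_atoo : V r @[r --> +oo%R] --> +oo%R ;
  volume_doubling : exists2 c : R, 1 < c & forall r : R, 0 < r -> V (2 * r) <= c * V r
}.

Definition volume_regular (mu : {measure set (borel M) -> \bar R})
    (V : R -> R) : Prop :=
  exists2 C : R, 1 <= C & forall (x : M) (r : R), 0 < r ->
    ((C^-1 * V r)%:E <= mu (ball x r) /\ mu (ball x r) <= (C * V r)%:E)%E.

Record scale_function (phi : R -> R) : Prop := {
  scale_gt0 : forall r : R, 0 < r -> 0 < phi r ;
  scale_increasing : forall r s : R, 0 < r -> r < s -> phi r < phi s ;
  scale_growth : exists c3 c4 d3 d4 : R,
    [/\ 0 < c3, 0 < c4, 0 < d3, 0 < d4 &
      forall r s : R, 0 < r -> r <= s ->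
        c3 * (s / r) `^ d3 <= phi s / phi r /\
        phi s / phi r <= c4 * (s / r) `^ d4]
}.

Section Form.
Context (mu : {measure set (borel M) -> \bar R}).

(* Elements of L^2(M, mu) are represented by Borel functions, equality in L^2
   being almost everywhere equality. *)
Definition L2 (u : M -> R) : Prop := (u : borel M -> R) \in Lfun mu 2%:E.

Definition aeq (u v : M -> R) : Prop := {ae mu, forall x, u x = v x}.

Definition ip (u v : M -> R) : R := \int[mu]_x (u x * v x).

Definition Cc (u : M -> R) : Prop :=
  continuous u /\ precompact [set x | u x != 0].

Definition form1 (E : (M -> R) -> (M -> R) -> R) (u v : M -> R) : R :=
  E u v + ip u v.

Record dirichlet_form (F : set (M -> R)) (E : (M -> R) -> (M -> R) -> R) :
    Prop := {
  form_L2 : forall u, F u -> L2 u ;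
  form_domain_ae : forall u v, F u -> L2 v -> aeq u v -> F v ;
  form_ae : forall u v w, F u -> F v -> F w -> aeq u v -> E u w = E v w ;
  form_domain0 : F (cst 0) ;
  form_domainP : forall (a : R) u v, F u -> F v -> F (fun x => a * u x + v x) ;
  form_linear : forall (a : R) u v w, F u -> F v -> F w ->
    E (fun x => a * u x + v x) w = a * E u w + E v w ;
  form_sym : forall u v, F u -> F v -> E u v = E v u ;
  form_ge0 : forall u, F u -> 0 <= E u u ;
  form_dense : forall u, L2 u -> forall e : R, 0 < e ->
    exists2 v, F v & ip (u \- v) (u \- v) < e ;
  form_closed : forall u : nat -> M -> R, (forall n, F (u n)) ->
    (forall e : R, 0 < e -> exists N : nat, forall m n : nat,
      (N <= m)%N -> (N <= n)%N -> form1 E (u m \- u n) (u m \- u n) < e) ->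
    exists2 v, F v & form1 E (u n \- v) (u n \- v) @[n --> \oo] --> 0 ;
  form_markov : forall u, F u ->
    let v := fun x => Num.min (Num.max (u x) 0) 1 in F v /\ E v v <= E u u
}.

Record regular_form (F : set (M -> R)) (E : (M -> R) -> (M -> R) -> R) :
    Prop := {
  regular_dense_form : forall u, F u -> forall e : R, 0 < e ->
    exists v, [/\ F v, Cc v & form1 E (u \- v) (u \- v) < e] ;
  regular_dense_unif : forall u, Cc u -> forall e : R, 0 < e ->
    exists v, [/\ F v, Cc v & forall x, `|u x - v x| < e]
}.

Definition diag : set (M * M) := [set z | z.1 = z.2].

Definition pure_jump (F : set (M -> R)) (E : (M -> R) -> (M -> R) -> R)
    (n : {measure set (borel (M * M)%type) -> \bar R}) : Prop :=
  [/\ radon_on (~` diag) n,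
      forall A : set (borel (M * M)%type), measurable A -> A `<=` ~` diag ->
        n [set z | A (z.2, z.1)] = n A &
      forall u v, F u -> F v -> Cc u -> Cc v ->
        (E u v)%:E =
        (\int[n]_(z in ~` diag) ((u z.1 - u z.2) * (v z.1 - v z.2))%:E)%E].

Record l2_semigroup (T : R -> (M -> R) -> (M -> R)) : Prop := {
  semigroup_L2 : forall (t : R) u, 0 < t -> L2 u -> L2 (T t u) ;
  semigroup_ae : forall (t : R) u v, 0 < t -> L2 u -> L2 v -> aeq u v ->
    aeq (T t u) (T t v) ;
  semigroup_linear : forall (t a : R) u v, 0 < t -> L2 u -> L2 v ->
    aeq (T t (fun x => a * u x + v x)) (fun x => a * T t u x + T t v x) ;
  semigroup_add : forall (s t : R) u, 0 < s -> 0 < t -> L2 u ->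
    aeq (T (s + t) u) (T s (T t u)) ;
  semigroup_sym : forall (t : R) u v, 0 < t -> L2 u -> L2 v ->
    ip (T t u) v = ip u (T t v) ;
  semigroup_contraction : forall (t : R) u, 0 < t -> L2 u ->
    ip (T t u) (T t u) <= ip u u ;
  semigroup_continuous : forall u, L2 u ->
    ip (T t u \- u) (T t u \- u) @[t --> 0^'+] --> 0
}.

Definition approx_form (T : R -> (M -> R) -> (M -> R)) (t : R) (u v : M -> R)
    : R :=
  t^-1 * ip (u \- T t u) v.

(* (E, F) is the form of the semigroup T: since t |-> approx_form T t u u is
   nonincreasing, the limit at 0+ always exists in [0, +oo], and F consists of
   the u in L^2 for which it is finite. *)
Definition form_of_semigroup (T : R -> (M -> R) -> (M -> R))
    (F : set (M -> R)) (E : (M -> R) -> (M -> R) -> R) : Prop :=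
  (forall u, F u <-> L2 u /\ cvg (approx_form T t u u @[t --> 0^'+])) /\
  (forall u v, F u -> F v -> approx_form T t u v @[t --> 0^'+] --> E u v).

End Form.

(* [None] is the cemetery; it is isolated when M is compact. *)
Notation Mdel := (one_point_compactification M).

Section Process.
Context (d : measure_display) (Om : measurableType d).
Context (P : Mdel -> probability Om R) (Ft : R -> set (set Om)).
Context (X : R -> Om -> Mdel).

(* [Ft] and [X] are only meaningful at nonnegative times. *)
Definition stopping_time (sigma : Om -> \bar R) : Prop :=
  (forall w, (0 <= sigma w)%E) /\
  (forall t : R, 0 <= t -> Ft t [set w | (sigma w <= t%:E)%E]).

Definition stopped_algebra (sigma : Om -> \bar R) : set (set Om) :=
  [set A | measurable A /\
    forall t : R, 0 <= t -> Ft t (A `&` [set w | (sigma w <= t%:E)%E])].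

Definition stopped (sigma : Om -> \bar R) (w : Om) : Mdel :=
  if sigma w is t%:E then X t w else None.

Definition lifetime (w : Om) : \bar R :=
  ereal_inf [set t%:E | t in [set t : R | 0 <= t /\ X t w = None]].

Record right_continuous_filtration : Prop := {
  filtration_sigma : forall t : R, 0 <= t -> sigma_algebra setT (Ft t) ;
  filtration_measurable : forall t : R, 0 <= t -> Ft t `<=` measurable ;
  filtration_mono : forall s t : R, 0 <= s -> s <= t -> Ft s `<=` Ft t ;
  filtration_right : forall t : R, 0 <= t ->
    \bigcap_(s in [set s : R | t < s]) Ft s `<=` Ft t
}.

Record hunt_process : Prop := {
  hunt_filtration : right_continuous_filtration ;
  hunt_adapted : forall (t : R) (A : set (borel Mdel)), 0 <= t -> measurable A ->
    Ft t (X t @^-1` A) ;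
  hunt_kernel : forall (t : R) (A : set (borel Mdel)), 0 <= t -> measurable A ->
    measurable_fun setT (fun x : borel Mdel => (P x (X t @^-1` A) : \bar R)) ;
  hunt_normal : forall x : Mdel, {ae P x, forall w, X 0 w = x} ;
  hunt_cemetery : forall w (t : R), 0 <= t -> (lifetime w <= t%:E)%E -> X t w = None ;
  hunt_shift : forall t : R, 0 <= t -> exists theta : Om -> Om,
    forall (s : R) w, 0 <= s -> X s (theta w) = X (s + t) w ;
  hunt_right_continuous : forall w (t : R), 0 <= t -> X s w @[s --> t^'+] --> X t w ;
  hunt_left_limits : forall w (t : R), 0 < t -> cvg (X s w @[s --> t^'-]) ;
  hunt_strong_markov : forall (x : Mdel) (sigma : Om -> \bar R) (s : R)
      (A : set Om) (B : set (borel Mdel)),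
    stopping_time sigma -> 0 <= s -> stopped_algebra sigma A -> measurable B ->
    let A' := A `&` [set w | (sigma w < +oo)%E] in
    (P x (A' `&` stopped (fun w => sigma w + s%:E) @^-1` B)
      = \int[P x]_(w in A') P (stopped sigma w) (X s @^-1` B))%E ;
  hunt_quasi_left_continuous : forall (x : Mdel)
      (sigma_ : nat -> Om -> \bar R) (sigma : Om -> \bar R),
    (forall n, stopping_time (sigma_ n)) -> stopping_time sigma ->
    (forall w, nondecreasing_seq (sigma_^~ w)) ->
    (forall w, sigma_ n w @[n --> \oo] --> sigma w) ->
    {ae P x, forall w, (sigma w < +oo)%E ->
      stopped (sigma_ n) w @[n --> \oo] --> stopped sigma w}
}.

Definition nearly_borel (A : set M) : Prop :=
  forall nu : probability (borel Mdel) R,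
  exists A1 A2 : set (borel M),
    [/\ measurable A1, measurable A2, A1 `<=` A, A `<=` A2 &
      {ae nu, forall x : Mdel, {ae P x, forall w,
        forall t : R, 0 <= t -> ~ (Some @` (A2 `\` A1)) (X t w)}}].

Record properly_exceptional (mu : {measure set (borel M) -> \bar R})
    (N : set M) : Prop := {
  exceptional_nearly_borel : nearly_borel N ;
  exceptional_null : mu.-negligible (N : set (borel M)) ;
  exceptional_invariant : forall x : M, ~ N x -> {ae P (Some x), forall w,
    (forall t : R, 0 <= t -> ~ (Some @` N) (X t w)) /\
    (forall (t : R) (y : M), 0 < t -> N y ->
      ~ (X s w @[s --> t^'-] --> (Some y : Mdel)))}
}.

(* Functions on M are extended by 0 to the cemetery. *)
Definition transition (t : R) (f : M -> R) (x : M) : \bar R :=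
  (\int[P (Some x)]_w (oapp f 0 (X t w))%:E)%E.

Definition associated_process (mu : {measure set (borel M) -> \bar R})
    (F : set (M -> R)) (E : (M -> R) -> (M -> R) -> R) : Prop :=
  exists T : R -> (M -> R) -> (M -> R),
    [/\ l2_semigroup mu T, form_of_semigroup mu T F E &
      forall (t : R) f, 0 < t -> L2 mu f ->
        {ae mu, forall x, transition t f x = (T t f x)%:E}].

Record heat_kernel (mu : {measure set (borel M) -> \bar R}) (N : set M)
    (p : R -> M -> M -> R) : Prop := {
  heat_kernel_ge0 : forall (t : R) x y, 0 < t -> 0 <= p t x y ;
  heat_kernel_sym : forall (t : R) x y, 0 < t -> p t x y = p t y x ;
  heat_kernel_measurable :
    measurable_fun [set z : R * borel M * borel M | 0 < z.1.1]
      (fun z : R * borel M * borel M => p z.1.1 z.1.2 z.2) ;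
  heat_kernel_transition : forall (t : R) (f : borel M -> R) x, 0 < t ->
    measurable_fun setT f -> (forall y, 0 <= f y) -> ~ N x ->
    transition t f x = (\int[mu]_z (p t x z * f z)%:E)%E ;
  heat_kernel_chapman_kolmogorov : forall (s t : R) x, 0 < s -> 0 < t -> ~ N x ->
    {ae mu, forall y,
      ((p (t + s) x y)%:E = \int[mu]_z (p t x z * p s z y)%:E)%E}
}.

Definition conservative (mu : {measure set (borel M) -> \bar R}) (N : set M)
    (p : R -> M -> M -> R) : Prop :=
  forall (t : R) x, 0 < t -> ~ N x -> (\int[mu]_y (p t x y)%:E = 1)%E.

(* The cemetery is at infinite distance from every point of M. *)
Definition edist (z : Mdel) (x : M) : \bar R :=
  if z is Some y then (mdist y x)%:E else +oo%E.

Definition sup_displacement (x : M) (t : R) (w : Om) : \bar R :=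
  ereal_sup [set edist (X s w) x | s in [set s : R | 0 <= s /\ s <= t]].

End Process.
End Space.

(* Main.v *)
(* Summing the heat kernel bound over dyadic annuli gives, for a < t < b,
   P^x(d(X_t, x) >= r) <= K t / phi(r).  Conservativeness and an
   Ottaviani-type argument turn this into the same bound, up to a constant, for
   the maximum of d(X_s, x) over a finite grid of [0, t], hence for the
   supremum over [0, t] by right continuity; only the Markov property at
   deterministic times is needed.  With s_k = 2^(-k) or 2^k, the events
   sup_(s <= 2 s_k) d(X_s, x) > e varphi(s_k) then have probability at most
   C_e s_k / phi(varphi(s_k)), which is at most 2 C_e times the integral of
   1 / phi(varphi) over ](s_k / 2), s_k].  These are summable, so Borel-Cantelli
   and the monotonicity of varphi conclude. *)

Require Import Defs.
From HB Require Import structures.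
From mathcomp Require Import all_boot all_order all_algebra.
From mathcomp Require Import all_classical all_reals all_analysis.
From mathcomp Require Import measurable_realfun.
From mathcomp Require Import ring lra.

Set Implicit Arguments.
Unset Strict Implicit.
Unset Printing Implicit Defensive.

Import Order.TTheory GRing.Theory Num.Theory.
Import numFieldNormedType.Exports.

Local Open Scope classical_set_scope.
Local Open Scope ring_scope.

(** * Borel sets of [M] and of its one-point compactification *)

Section BorelSets.
Context (R : realType) (M : pmetricType R).

Lemma open_borel (T : ptopologicalType) (A : set T) :
  open A -> measurable (A : set (borel T)).
Proof. by move=> oA; exact: sub_sigma_algebra. Qed.

(** The sets with measurable image form a sigma-algebra, which contains the open sets because [Some]
    is an open map. Complements are taken inside the image of the whole space. *)
Lemma measurable_image_Some (T : ptopologicalType) (A : set (borel T)) :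
  measurable A ->
  measurable (Some @` A : set (borel (one_point_compactification T))).
Proof.
pose S := [set A : set (borel T) |
  measurable (Some @` A : set (borel (one_point_compactification T)))].
have mS U : open (U : set T) -> S U.
  by move=> oU; apply: open_borel; exact: one_point_compactification_open_some.
move=> mA; apply: (mA S); split; last exact: mS.
split.
- by rewrite /S /= image_set0.
- move=> B SB; rewrite /S /=.
  rewrite [X in measurable X](_ : _ = Some @` [set: T] `\` Some @` B); last first.
    apply/seteqP; split=> [_ [y [_ By] <-]|_ [[y _ <-] nB]].
      by split; [exists y|move=> [z Bz [zy]]; apply: By; rewrite -zy].
    by exists y => //; split=> // By; apply: nB; exists y.
  apply: measurableD; last exact: SB.
  apply: open_borel.
  by apply: one_point_compactification_open_some; exact: openT.
- by move=> F SF; rewrite /S /= image_bigcup; apply: bigcup_measurable => k _; exact: SF.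
Qed.

Lemma open_ball_metric (x : M) (r : R) : open (ball x r).
Proof.
rewrite openE => y; rewrite ballEmdist /= => yr.
have e0 : 0 < r - mdist x y by rewrite subr_gt0.
apply: filterS (nbhsx_ballx y _ e0) => z; rewrite !ballEmdist /= => yz.
have := metric_triangle x y z; lra.
Qed.

Lemma measurable_ball_metric (x : M) (r : R) :
  measurable (ball x r : set (borel M)).
Proof. by apply: open_borel; exact: open_ball_metric. Qed.

Lemma ge_mdistE (x : M) (r : R) :
  [set y | r <= mdist x y] = ~` ball x r.
Proof.
by rewrite ballEmdist; apply/seteqP; split=> y /=; rewrite leNgt => /negP.
Qed.

Lemma measurable_ge_mdist (x : M) (r : R) :
  measurable ([set y | r <= mdist x y] : set (borel M)).
Proof. by rewrite ge_mdistE; apply: measurableC; exact: measurable_ball_metric. Qed.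

(** The cemetery is left out; death is excluded separately, by conservativeness. *)
Definition far_from (x : M) (r : R) : set (one_point_compactification M) :=
  Some @` [set y | r <= mdist x y].

Lemma measurable_far_from (x : M) (r : R) :
  measurable (far_from x r : set (borel (one_point_compactification M))).
Proof. by apply: measurable_image_Some; exact: measurable_ge_mdist. Qed.

Lemma open_gt_mdist (x : M) (r : R) : open [set y | r < mdist x y].
Proof.
rewrite openE => y /= ry.
have e0 : 0 < mdist x y - r by rewrite subr_gt0.
apply: filterS (nbhsx_ballx y _ e0) => z; rewrite ballEmdist /= => yz.
have := metric_triangle x z y; rewrite (metric_sym z y); lra.
Qed.

End BorelSets.

(** * Transition probabilities through the heat kernel *)

Section HeatKernel.
Context (R : realType) (M : pmetricType R).
Context (mu : {measure set (borel M) -> \bar R}).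
Context (d : measure_display) (Om : measurableType d).
Context (P : one_point_compactification M -> probability Om R) (Ft : R -> set (set Om)).
Context (X : R -> Om -> one_point_compactification M) (X_hunt : hunt_process P Ft X).
Context (N : set M) (p : R -> M -> M -> R).
Context (p_heat_kernel : heat_kernel P X mu N p).

Lemma measurable_preimage_process (t : R) (A : set (borel (one_point_compactification M))) :
  0 <= t -> measurable A -> measurable (X t @^-1` A).
Proof.
move=> t0 mA.
apply: (filtration_measurable (hunt_filtration X_hunt) t0).
exact: (hunt_adapted X_hunt).
Qed.

Lemma measurable_heat_kernel (t : R) (x : M) : 0 < t ->
  measurable_fun [set: borel M] (p t x).
Proof.
move=> t0.
have mF : measurable [set z : R * borel M * borel M | 0 < z.1.1].
  rewrite (_ : [set _ | _] = (`]0, +oo[ `*` [set: borel M]) `*` [set: borel M]).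
    by apply: measurableX => //; exact: measurableX.
  by apply/seteqP; split=> -[[u v] w]/=; rewrite in_itv/= andbT; tauto.
apply: (@measurable_comp _ _ _ _ _ _ _ _ _ (pair ((t, x) : R * borel M)) mF _
  (heat_kernel_measurable p_heat_kernel)) => //.
by move=> _ [y _ <-].
Qed.

(** The indicator of [A], extended by 0 to the cemetery, is the indicator of the image of [A] under
    [Some], so [heat_kernel_transition] applies to it. *)
Lemma transition_probE (t : R) (x : M) (A : set (borel M)) : 0 < t -> ~ N x ->
  measurable A ->
  P (Some x) (X t @^-1` (Some @` A)) = (\int[mu]_z (p t x z * \1_A z)%:E)%E.
Proof.
move=> t0 Nx mA.
rewrite -(heat_kernel_transition p_heat_kernel (f := \1_A))//.
have mB : measurable (X t @^-1` (Some @` A)).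
  apply: measurable_preimage_process; first exact: ltW.
  exact: measurable_image_Some.
transitivity (\int[P (Some x)]_w (\1_(X t @^-1` (Some @` A)) w)%:E)%E.
  by rewrite integral_indic// setIT.
apply: eq_integral => w _; congr EFin; rewrite indicE.
have -> : (w \in X t @^-1` (Some @` A)) = (X t w \in Some @` A).
  by apply/idP/idP; rewrite !inE.
case: (X t w) => [y|]; last by rewrite memNset// => -[].
by rewrite /= indicE; congr (nat_of_bool _)%:R; rewrite mem_image//; exact: Some_inj.
Qed.

Lemma transition_prob_le (t : R) (x : M) (A : set (borel M)) (c : R) :
  0 < t -> ~ N x -> measurable A -> 0 <= c ->
  {ae mu, forall y, A y -> p t x y <= c} ->
  (P (Some x) (X t @^-1` (Some @` A)) <= c%:E * mu A)%E.
Proof.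
move=> t0 Nx mA c0 pc; rewrite transition_probE//.
apply: (@le_trans _ _ (\int[mu]_z (c * \1_A z)%:E)%E); last first.
  rewrite (@integralZl_indic _ _ _ mu setT _ (fun=> A))//.
    by rewrite integral_indic// setIT.
  by move=> c0'; have := lt_le_trans c0' c0; rewrite ltxx.
apply: ae_ge0_le_integral => //.
- by move=> z _; rewrite lee_fin mulr_ge0//; exact: (heat_kernel_ge0 p_heat_kernel).
- apply/measurable_EFinP; apply: measurable_funM => //.
  exact: measurable_heat_kernel.
- by move=> z _; rewrite lee_fin mulr_ge0.
- by apply/measurable_EFinP; apply: measurable_funM.
apply: filterS pc => z Azc _; rewrite lee_fin indicE.
have [zA|zA] := boolP (z \in A); last by rewrite !mulr0.
by rewrite !mulr1; apply: Azc; rewrite inE in zA.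
Qed.

End HeatKernel.

(** * Geometric series and dyadic brackets *)

Lemma nneseries_le_geometric (R : realType) (u : nat -> \bar R) (c z : R) :
  0 <= c -> 0 < z < 1 -> (forall k, 0 <= u k)%E ->
  (forall k, u k <= (c * z ^+ k)%:E)%E ->
  (\sum_(0 <= k <oo) u k <= (c / (1 - z))%:E)%E.
Proof.
move=> c0 /andP[z0 z1] u0 uc; apply: lime_le.
  by apply: is_cvg_nneseries => k _ _; exact: u0.
apply: nearW => n; apply: (@le_trans _ _ (\sum_(0 <= k < n) (c * z ^+ k)%:E)%E).
  exact: lee_sum.
rewrite sumEFin lee_fin; apply: (geometric_le_lim n) => //.
by rewrite gtr0_norm.
Qed.

Lemma exists_pow2_gt (R : realType) (s : R) : exists k : nat, s < 2 ^+ k.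
Proof.
exists (Num.trunc s).+1; apply: lt_le_trans (truncnS_gt s) _.
by rewrite -natrX ler_nat ltnW// ltn_expl.
Qed.

Lemma dyadic_bracket (R : realType) (s : R) : 1 <= s ->
  exists k : nat, 2 ^+ k <= s < 2 ^+ k.+1.
Proof.
move=> s1; case: (ex_minnP (exists_pow2_gt s)) => -[|k] sk kmin.
  by move: sk; rewrite expr0; lra.
by exists k; rewrite sk andbT leNgt; apply/negP => /kmin; rewrite ltnn.
Qed.

(** * Tail of the displacement at a fixed time *)

Section Tail.
Context (R : realType) (M : pmetricType R).
Context (mu : {measure set (borel M) -> \bar R}).
Context (V : R -> R) (V_volume : volume_function V).
Context (mu_volume : volume_regular mu V).
Context (d : measure_display) (Om : measurableType d).
Context (P : one_point_compactification M -> probability Om R).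
Context (Ft : R -> set (set Om)).
Context (X : R -> Om -> one_point_compactification M).
Context (X_hunt : hunt_process P Ft X).
Context (N : set M) (p : R -> M -> M -> R).
Context (p_heat_kernel : heat_kernel P X mu N p).
Context (phi : R -> R) (phi_scale : scale_function phi).
Context (a : R) (b : \bar R) (a_ge0 : 0 <= a).
Context (C : R) (C_gt0 : 0 < C).
Context (p_upper_bound : forall (t : R) (x : M),
  a < t -> (t%:E < b)%E -> ~ N x ->
  {ae mu, forall y, x != y ->
    p t x y <= C * t / (V (mdist x y) * phi (mdist x y))}).

(* Sum over the annuli [2^k r <= d(x, y) < 2^(k+1) r]: doubling cancels V, and
   the lower scaling of phi makes the remaining series geometric. *)
Lemma tail_bound : exists2 K : R, 0 < K & forall (t r : R) (x : M),
  a < t -> (t%:E < b)%E -> 0 < r -> ~ N x ->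
  (P (Some x) (X t @^-1` far_from x r)
    <= (K * t / phi r)%:E)%E.
Proof.
have [V0 Vinc _ _ [c c1 Vdbl]] := V_volume.
have [Cs Cs1 muV] := mu_volume.
have [phi0 phiinc [c3 [c4 [d3 [d4 [c30 _ d30 _ phig]]]]]] := phi_scale.
have c0 : 0 < c by lra.
have Cs0 : 0 < Cs by lra.
(* With [q = 2^k r], lower scaling reads [phi q >= c3 phi r / z^k], so [z] is the ratio of the
   series. *)
pose z : R := (2 `^ d3)^-1.
have z0 : 0 < z by rewrite invr_gt0 powR_gt0.
have z1 : z < 1.
  have : 1 `^ d3 < 2 `^ d3 by apply: (gt0_ltr_powR d30); rewrite ?nnegrE ?ltr1n.
  by rewrite powR1 invf_lt1 ?powR_gt0.
(* [C] comes from the heat kernel, [Cs] and [c] from the volume of the ball of radius [2 q], [c3]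
   from the scaling of [phi], and [1 - z] from the series. *)
exists (C * Cs * c / c3 / (1 - z)).
  by rewrite !divr_gt0 ?mulr_gt0// subr_gt0.
move=> t r x t_a t_b r0 Nx.
have t0 : 0 < t by exact: le_lt_trans t_a.
pose A k := ball x (2 ^+ k.+1 * r) `\` ball x (2 ^+ k * r) : set (borel M).
have mA k : measurable (A k) by apply: measurableD; exact: measurable_ball_metric.
have phir := phi0 _ r0.
have PA k : (P (Some x) (X t @^-1` (Some @` A k))
    <= (C * Cs * c / c3 * t / phi r * z ^+ k)%:E)%E.
  set q := 2 ^+ k * r.
  have rq : r <= q by apply: ler_peMl; [exact: ltW|apply: exprn_ege1; rewrite ler1n].
  have q0 : 0 < q by exact: lt_le_trans rq.
  have Vq := V0 _ q0. have phiq := phi0 _ q0.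
  have mono (f : R -> R) (f_inc : forall r s : R, 0 < r -> r < s -> f r < f s) s :
      q <= s -> f q <= f s.
    by rewrite le_eqVlt => /predU1P[->//|qs]; exact/ltW/f_inc.
  (* On the annulus [d(x, y) >= q > 0]: thus [y] differs from [x], and monotonicity of [V] and [phi]
     replaces the distance by the inner radius. *)
  apply: (@le_trans _ _ ((C * t / (V q * phi q))%:E * mu (A k))%E).
    apply: (transition_prob_le X_hunt p_heat_kernel) => //.
      by rewrite divr_ge0 ?mulr_ge0// ltW.
    apply: (filterS (Filter := ae_filter_ringOfSetsType mu) _
      (p_upper_bound t_a t_b Nx)) => y pxy [_].
    rewrite ballEmdist /= => /negP; rewrite -leNgt -/q => qy.
    apply: le_trans (pxy _) _.
      by rewrite -mdist_gt0; exact: lt_le_trans qy.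
    rewrite ler_pM2l ?mulr_gt0// lef_pV2 ?posrE ?mulr_gt0//.
    - by rewrite ler_pM ?mono// ltW.
    - by apply: V0; exact: lt_le_trans qy.
    - by apply: phi0; exact: lt_le_trans qy.
  have muA : (mu (A k) <= (Cs * (c * V q))%:E)%E.
    apply: (@le_trans _ _ (mu (ball x (2 * q)))).
      rewrite le_measure ?inE//; first exact: measurable_ball_metric.
      by rewrite /A exprS -mulrA -/q => y [].
    have q20 : 0 < 2 * q by rewrite mulr_gt0.
    apply: (le_trans (muV x _ q20).2).
    by rewrite lee_fin ler_pM2l// Vdbl.
  have cq0 : 0 <= C * t / (V q * phi q) by rewrite divr_ge0 ?mulr_ge0// ltW.
  apply: (le_trans (lee_wpmul2l _ muA)); first by rewrite lee_fin.
  rewrite -EFinM lee_fin.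
  have -> : C * t / (V q * phi q) * (Cs * (c * V q)) = C * Cs * c * t / phi q.
    by field; rewrite !gt_eqF.
  have -> : C * Cs * c / c3 * t / phi r * z ^+ k =
      C * Cs * c * t * (z ^+ k / (c3 * phi r)).
    by field; rewrite !gt_eqF.
  have W0 : 0 < (2 `^ d3) ^+ k by rewrite exprn_gt0// powR_gt0.
  rewrite ler_pM2l ?mulr_gt0// /z exprVn -invfM lef_pV2 ?posrE ?mulr_gt0//.
  have := (phig r q r0 rq).1; rewrite {1}/q mulfK ?gt_eqF//.
  rewrite -(powR_mulrn k)// -powRrM [k%:R * _]mulrC powRrM powR_mulrn ?powR_ge0//.
  by rewrite ler_pdivlMr// mulrCA mulrA.
rewrite [X in (_ <= X%:E)%E](_ : _ =
    (C * Cs * c / c3 * t / phi r) / (1 - z)); last by ring.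
apply: le_trans (nneseries_le_geometric _ _ _ PA) => //; last first.
- by rewrite z0.
- by rewrite !(mulr_ge0, divr_ge0, invr_ge0)// ltW.
apply: measure_sigma_subadditive.
- move=> k; apply: (measurable_preimage_process X_hunt (ltW t0)).
  exact: measurable_image_Some.
- apply: (measurable_preimage_process X_hunt (ltW t0)).
  exact: measurable_far_from.
move=> w [y /= ry yw].
(* The annulus containing [y] is read off from the dyadic bracket of [d(x, y) / r >= 1]. *)
have [k /andP[k1 k2]] : exists k : nat, 2 ^+ k <= mdist x y / r < 2 ^+ k.+1.
  by apply: dyadic_bracket; rewrite ler_pdivlMr// mul1r.
exists k => //; exists y => //; rewrite /A !ballEmdist; split => /=.
  by rewrite -ltr_pdivrMr.
by apply/negP; rewrite -leNgt -ler_pdivlMr.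
Qed.

End Tail.

(** * Maximal inequality for the displacement over [[0, t]] *)

Section Maximal.
Context (R : realType) (M : pmetricType R).
Context (mu : {measure set (borel M) -> \bar R}).
Context (d : measure_display) (Om : measurableType d).
Context (P : one_point_compactification M -> probability Om R).
Context (Ft : R -> set (set Om)).
Context (X : R -> Om -> one_point_compactification M).
Context (X_hunt : hunt_process P Ft X).
Context (N : set M) (N_exceptional : properly_exceptional P X mu N).
Context (p : R -> M -> M -> R) (p_heat_kernel : heat_kernel P X mu N p).
Context (X_conservative : conservative mu N p).

(** This is the strong Markov property at the constant stopping time [u]: the event [u <= t] is
    everything or empty. *)
Lemma markov_property (x : one_point_compactification M) (u s : R) (A : set Om)
    (B : set (borel (one_point_compactification M))) :
  0 <= u -> 0 <= s -> Ft u A -> measurable B ->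
  (P x (A `&` X (u + s) @^-1` B) = \int[P x]_(w in A) P (X u w) (X s @^-1` B))%E.
Proof.
move=> u0 s0 FA mB; have hF := hunt_filtration X_hunt.
have FtT t : 0 <= t -> Ft t setT.
  move=> t0; have [F0 FC _] := filtration_sigma hF t0.
  by rewrite -setC0 -setTD; exact: FC.
have Ft0 t : 0 <= t -> Ft t set0.
  by move=> t0; have [] := filtration_sigma hF t0.
have cst_stopping : stopping_time Ft (fun=> u%:E).
  split=> [w|t t0]; first by rewrite lee_fin.
  have [ut|ut] := boolP (u <= t).
    rewrite [X in Ft t X](_ : _ = setT); first exact: FtT.
    by apply/seteqP; split=> // w _ /=; rewrite lee_fin.
  rewrite [X in Ft t X](_ : _ = set0); first exact: Ft0.
  by rewrite -subset0 => w /=; rewrite lee_fin (negPf ut).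
have A_stopped : stopped_algebra Ft (fun=> u%:E) A.
  split; first exact: (filtration_measurable hF u0).
  move=> t t0; have [ut|ut] := boolP (u <= t).
    rewrite [X in _ `&` X](_ : _ = setT); last first.
      by apply/seteqP; split=> // w _ /=; rewrite lee_fin.
    by rewrite setIT; exact: (filtration_mono hF u0 ut).
  rewrite [X in _ `&` X](_ : _ = set0) ?setI0; first exact: Ft0.
  by rewrite -subset0 => w /=; rewrite lee_fin (negPf ut).
have := hunt_strong_markov X_hunt x cst_stopping s0 A_stopped mB.
rewrite /= (_ : [set w | _] = setT) ?setIT//.
by apply/seteqP; split=> // w _ /=; rewrite ltry.
Qed.

(** By conservativeness the whole mass sits on [M], so none is left for the cemetery. *)
Lemma survives (t : R) (x : M) : 0 < t -> ~ N x ->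
  {ae P (Some x), forall w, X t w <> None}.
Proof.
move=> t0 Nx.
have mT : measurable (X t @^-1` (Some @` [set: M])).
  apply: (measurable_preimage_process X_hunt (ltW t0)).
  exact: measurable_image_Some.
exists (~` (X t @^-1` (Some @` [set: M]))); split.
- exact: measurableC.
- rewrite probability_setC// (transition_probE X_hunt p_heat_kernel)//.
  under eq_integral do rewrite indicT mulr1.
  by rewrite X_conservative// subee.
- by move=> w /= /contrapT XN [y _]; rewrite XN.
Qed.

(** The cemetery is absorbing, so survival at the countably many positive integer times gives
    survival at all times; proper exceptionality keeps the path out of [N]. *)
Lemma stays_in_regular_points (x : M) : ~ N x ->
  {ae P (Some x), forall w,
    forall t, 0 <= t -> exists2 y, X t w = Some y & ~ N y}.
Proof.
move=> Nx.
have alive : {ae P (Some x), forall w, forall k : nat, X k.+1%:R w <> None}.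
  by apply: ae_foralln => k; exact: survives.
apply: filterS2 alive (exceptional_invariant N_exceptional Nx) => w Xk [XN _] t t0.
case Xt : (X t w) => [y|].
  by exists y => // Ny; apply: (XN _ t0); exists y.
exfalso; apply: (Xk (Num.trunc t)).
apply: (hunt_cemetery X_hunt) => //.
apply: (@le_trans _ _ t%:E); last by rewrite lee_fin ltW// truncnS_gt.
by apply: ereal_inf_lbound; exists t.
Qed.

(* Ottaviani's argument along the first index [j] at which [d(X_(u j), x) > r]:
   by time [2 t] the process either is still far from [x], or has moved by at
   least [r / 2] since the time [u j]. *)
Lemma grid_maximal_inequality (x : M) (t r q : R) (n : nat) (u : nat -> R) :
  0 < t -> 0 < r -> 0 <= q -> ~ N x ->
  (forall s y, t <= s <= 2 * t -> ~ N y ->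
    (P (Some y) (X s @^-1` far_from y (r / 2)) <= q%:E)%E) ->
  (forall j, 0 <= u j <= t) -> {homo u : i j / (i <= j)%N >-> i <= j} ->
  (P (Some x) (\big[setU/set0]_(j < n)
    X (u j) @^-1` (Some @` [set y | (r < mdist x y)%R])) <= (2 * q)%:E)%E.
Proof.
move=> t0 r0 q0 Nx tail u0t u_mono.
have u0 j : 0 <= u j by case/andP: (u0t j).
have ut j : u j <= t by case/andP: (u0t j).
set E := fun j => X (u j) @^-1` (Some @` [set y | r < mdist x y]).
(* On [A j], [j] is the first index with [d(X_(u j), x) > r]. *)
pose A := seqDU E.
have mU : measurable (Some @` [set y | r < mdist x y] :
    set (borel (one_point_compactification M))).
  by apply: measurable_image_Some; apply: open_borel; exact: open_gt_mdist.
have mE j : measurable (E j) by exact: (measurable_preimage_process X_hunt).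
(* [A j] involves only times [u i] with [i <= j], which do not exceed [u j]. *)
have FA j : Ft (u j) (A j).
  have F_sigma := filtration_sigma (hunt_filtration X_hunt) (u0 j).
  rewrite -(sigma_algebra_id F_sigma).
  have FE i : (i <= j)%N ->
      measurable (E i : set (g_sigma_algebraType (Ft (u j)))).
    move=> ij; apply: sub_sigma_algebra.
    apply: (filtration_mono (hunt_filtration X_hunt) (u0 i) (u_mono _ _ ij)).
    exact: (hunt_adapted X_hunt).
  apply: (@measurableD _ (g_sigma_algebraType (Ft (u j)))); first exact: FE.
  by apply: bigsetU_measurable => i _; apply: FE; exact: ltnW (ltn_ord i).
have mA j : measurable (A j).
  exact: (filtration_measurable (hunt_filtration X_hunt) (u0 j)).
have tA : trivIset setT A by exact: trivIset_seqDU.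
pose B := Some @` (ball x (r / 2)) : set (borel (one_point_compactification M)).
have mB : measurable B.
  by apply: measurable_image_Some; exact: measurable_ball_metric.
have t20' : 0 < 2 * t by rewrite mulr_gt0.
have t20 := ltW t20'.
(* Observing at time [2 t] leaves a remaining time [2 t - u j] in [[t, 2 t]], where [tail] is
   available. On [A j] the process sits at some [y] with [d(x, y) > r], so ending in [B] forces a
   move of at least [r / 2] away from [y]. *)
have PA j : (P (Some x) (A j `&` X (2 * t) @^-1` B) <= q%:E * P (Some x) (A j))%E.
  have s0 : 0 <= 2 * t - u j by have := ut j; lra.
  have -> : 2 * t = u j + (2 * t - u j) by lra.
  rewrite (markov_property _ (u0 j) s0 (FA j) mB).
  rewrite -integral_cst//; apply: ae_ge0_le_integral => //.
  - have mXu : measurable_fun [set: Om]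
        (X (u j) : Om -> borel (one_point_compactification M)).
      by move=> _ Y mY; rewrite setTI; exact: (measurable_preimage_process X_hunt).
    apply: measurable_funTS.
    exact: (measurableT_comp (hunt_kernel X_hunt s0 mB) mXu).
  apply: filterS (stays_in_regular_points Nx) => w /(_ _ (u0 j))[y Xy Ny] [Aw _].
  case: Aw => y' /= ry'; rewrite Xy => -[y'y]; rewrite {}y'y in ry'.
  apply: le_trans (tail (2 * t - u j) y _ Ny); last first.
    by have := ut j; have := u0 j; lra.
  apply: le_measure; rewrite ?inE; try exact: (measurable_preimage_process X_hunt).
    by apply: (measurable_preimage_process X_hunt) => //; exact: measurable_far_from.
  move=> w' [z]; rewrite ballEmdist /= => xz zX; exists z => //=.
  by have := metric_triangle x z y; rewrite (metric_sym z y); lra.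
have -> : \big[setU/set0]_(j < n) E j = \big[setU/set0]_(j < n) A j.
  exact: bigsetU_seqDU.
set G := \big[setU/set0]_(j < n) A j.
have mG : measurable G by exact: bigsetU_measurable.
pose G1 := \big[setU/set0]_(j < n) (A j `&` X (2 * t) @^-1` B).
pose H := X (2 * t) @^-1` far_from x (r / 2).
have mH : measurable H.
  by apply: (measurable_preimage_process X_hunt) => //; exact: measurable_far_from.
have mXB : measurable (X (2 * t) @^-1` B).
  exact: (measurable_preimage_process X_hunt).
have mG1 : measurable G1.
  by apply: bigsetU_measurable => j _; exact: measurableI.
(* The [A j] are disjoint, so the bounds add up to [q P(G) <= q], without a factor [n]. *)
have PG1 : (P (Some x) G1 <= q%:E)%E.
  apply: (@le_trans _ _ (\sum_(j < n) q%:E * P (Some x) (A j))%E).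
    have mAB j : (j < n)%N -> measurable (A j `&` X (2 * t) @^-1` B).
      by move=> _; exact: measurableI.
    apply: (le_trans (Boole_inequality (P (Some x)) mAB)).
    by apply: lee_sum => j _; exact: PA.
  rewrite -ge0_sume_distrr; last by move=> *; exact: measure_ge0.
  rewrite -(measure_semi_additive_ord _ _ _ mG)//; last first.
    by move=> i j _ _ /(tA _ _ I I) /val_inj.
  rewrite -[leRHS]mule1; apply: lee_wpmul2l; first by rewrite lee_fin.
  exact: probability_le1.
have mHG : measurable (H `|` G1) by exact: measurableU.
apply: (@le_trans _ _ (P (Some x) (H `|` G1))); last first.
  apply: (le_trans (measureU2 _ _ _)) => //.
  rewrite mulr_natl mulr2n EFinD; apply: leeD => //; apply: tail => //; lra.
(* Off the null set [Z] the process is alive at time [2 t], and a path of [G] is then in [H] or in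
   [G1] according to its distance from [x]. *)
have [Z [mZ PZ ZN]] := survives t20' Nx.
apply: (@le_trans _ _ (P (Some x) (Z `|` (H `|` G1)))).
  apply: le_measure; rewrite ?inE//; first exact: measurableU.
  move=> w Gw; have [Xw|Xw] := pselect (X (2 * t) w = None).
    by left; apply: ZN => /(_ Xw).
  right; case Xy : (X (2 * t) w) Xw => [y|//] _.
  have [xy|xy] := leP (r / 2) (mdist x y); first by left; exists y.
  right; move: Gw; rewrite /G -(bigcup_mkord n A) => -[j jn Aj].
  rewrite /G1 -(bigcup_mkord n (fun j => A j `&` X (2 * t) @^-1` B)).
  exists j => //.
  by split=> //; rewrite /B /= Xy; exists y => //; rewrite ballEmdist.
apply: (le_trans (measureU2 _ _ _)) => //.
by rewrite [X in (X + _)%E]PZ add0e.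
Qed.

(* [sup_displacement] need not be measurable; by right continuity, as long as
   the process is alive, it is controlled by countably many dyadic times. *)
Definition exceeds (x : M) (r t : R) : set Om :=
  \bigcup_m \big[setU/set0]_(j < (2 ^ m).+1)
    X (t * j%:R / 2 ^+ m) @^-1` (Some @` [set y | r < mdist x y]).

Lemma measurable_exceeds (x : M) (r t : R) : 0 <= t ->
  measurable (exceeds x r t).
Proof.
move=> t0; apply: bigcup_measurable => m _; apply: bigsetU_measurable => j _.
apply: (measurable_preimage_process X_hunt); first by rewrite divr_ge0// mulr_ge0.
by apply: measurable_image_Some; apply: open_borel; exact: open_gt_mdist.
Qed.

(** The dyadic grids are nested and the grid bound does not depend on the mesh, so it passes to the
    union by continuity from below. *)
Lemma ottaviani_maximal_inequality (x : M) (t r q : R) :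
  0 < t -> 0 < r -> 0 <= q -> ~ N x ->
  (forall s y, t <= s <= 2 * t -> ~ N y ->
    (P (Some y) (X s @^-1` far_from y (r / 2)) <= q%:E)%E) ->
  (P (Some x) (exceeds x r t) <= (2 * q)%:E)%E.
Proof.
move=> t0 r0 q0 Nx tail.
pose U := Some @` [set y | r < mdist x y] : set (one_point_compactification M).
pose G m := \big[setU/set0]_(j < (2 ^ m).+1) X (t * j%:R / 2 ^+ m) @^-1` U.
have mG m : measurable (G m).
  apply: bigsetU_measurable => j _; apply: (measurable_preimage_process X_hunt).
    by rewrite divr_ge0// mulr_ge0// ltW.
  by apply: measurable_image_Some; apply: open_borel; exact: open_gt_mdist.
have GE m w : G m w <->
    exists2 j : nat, (j <= 2 ^ m)%N & U (X (t * j%:R / 2 ^+ m) w).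
  rewrite /G -(bigcup_mkord _ (fun j => X (t * j%:R / 2 ^+ m) @^-1` U)).
  by split=> -[j jm Uj]; exists j.
have GS : nondecreasing_seq G.
  apply/nondecreasing_seqP => m; apply/subsetPset => w /GE[j jm Uj].
  apply/GE; exists (2 * j)%N; first by rewrite expnS leq_mul2l.
  rewrite (_ : _ / _ = t * j%:R / 2 ^+ m)// natrM exprS.
  by field; rewrite expf_neq0.
have PG m : (P (Some x) (G m) <= (2 * q)%:E)%E.
  (* Truncating the index at [2 ^ m] keeps [u] monotone with values in [[0, t]] for every index,
     without changing it on the grid. *)
  pose u j := t * (minn j (2 ^ m))%:R / 2 ^+ m.
  have := @grid_maximal_inequality x t r q (2 ^ m).+1 u t0 r0 q0 Nx tail.
  rewrite /G => /(_ _ _); under eq_bigr => j _.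
    rewrite /u (minn_idPl _); last by rewrite -ltnS.
  over.
  apply.
  - move=> j; rewrite /u divr_ge0 ?mulr_ge0 ?(ltW t0)//= ler_pdivrMr ?exprn_gt0//.
    by rewrite ler_pM2l// -natrX ler_nat geq_minr.
  - move=> i j ij; rewrite /u ler_pM2r ?invr_gt0 ?exprn_gt0// ler_pM2l// ler_nat.
    by rewrite leq_min geq_minr andbT (leq_trans (geq_minl _ _)).
have mUG : measurable (\bigcup_m G m) by exact: bigcup_measurable.
have G_cvg := nondecreasing_cvg_mu (mu := P (Some x)) mG mUG GS.
rewrite /exceeds -/U -/(G _) -(cvg_lim _ G_cvg)//.
by apply: lime_le; [apply/cvg_ex; eexists; exact: G_cvg|exact: nearW].
Qed.

(** Being farther than [r] from [x] is an open condition: if it held at some [s < t], right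
    continuity would carry it to a grid time just after [s]. *)
Lemma sup_displacement_le (x : M) (t r : R) (w : Om) : 0 < t ->
  (forall s, 0 <= s -> X s w <> None) -> ~ exceeds x r t w ->
  (sup_displacement X x t w <= r%:E)%E.
Proof.
move=> t0 Xw nG.
have {}nG m j : (j <= 2 ^ m)%N ->
    ~ (Some @` [set y | r < mdist x y]) (X (t * j%:R / 2 ^+ m) w).
  move=> jm Uj; apply: nG; exists m => //.
  rewrite -(bigcup_mkord _ (fun j => X (t * j%:R / 2 ^+ m) @^-1`
    (Some @` [set y | r < mdist x y]))).
  by exists j.
apply: ge_ereal_sup => _ [s /= [s0 st] <-].
case Xs : (X s w) => [y|]; last by have := Xw s s0.
rewrite /= lee_fin leNgt; apply/negP => ry.
have Us : (Some @` [set y | r < mdist x y]) (X s w).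
  by rewrite Xs; exists y => //=; rewrite metric_sym.
(* The endpoint [t] is itself a grid time, for [m = 0] and [j = 1]. *)
have {}st : s < t.
  rewrite lt_neqAle st andbT; apply/eqP => stE.
  by apply: (nG 0%N 1%N) => //; rewrite mulr1 expr0 divr1 -stE.
have : nbhs (X s w) (Some @` [set y | r < mdist x y]).
  apply: open_nbhs_nbhs; split=> //.
  by apply: one_point_compactification_open_some; exact: open_gt_mdist.
move=> /(hunt_right_continuous X_hunt s0)/nbhs_ballP[e /= e0 es].
have [m tm] := exists_pow2_gt (t / e).
have m0 : 0 < 2 ^+ m :> R by rewrite exprn_gt0.
(* The first grid index strictly after [s], as the neighbourhood is one-sided; the mesh
   [t / 2^m < e] keeps its time within [e] of [s]. *)
pose j := (Num.trunc (s * 2 ^+ m / t)).+1.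
have sj : s * 2 ^+ m / t < j%:R by exact: truncnS_gt.
have js : j%:R <= s * 2 ^+ m / t + 1.
  by rewrite /j -natr1 lerD2r truncn_le divr_ge0 ?mulr_ge0// ltW.
apply: (nG m j).
  rewrite truncn_lt_nat; last by rewrite divr_ge0 ?mulr_ge0// ltW.
  by rewrite natrX ltr_pdivrMr// mulrC ltr_pM2l.
have lb : s < t * j%:R / 2 ^+ m by rewrite ltr_pdivlMr// [t * _]mulrC -ltr_pdivrMr.
apply: es => //=; rewrite -ball_normE /= distrC gtr0_norm ?subr_gt0//.
rewrite ltrBlDl ltr_pdivrMr//; apply: (@le_lt_trans _ _ (s * 2 ^+ m + t)).
  have := js; rewrite -(ler_pM2l t0) mulrDr mulr1.
  by rewrite [t * (_ / t)]mulrC divfK ?gt_eqF.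
by rewrite mulrDl ltrD2l mulrC -ltr_pdivrMr.
Qed.

End Maximal.

(** * Comparison of dyadic sums with integrals *)

Lemma nonincreasing_measurable_itv (R : realType) (J : interval R) (f : R -> R) :
  {in J &, {homo f : s t /~ s <= t}} -> measurable_fun [set` J] f.
Proof.
move=> f_ni; apply: (measurability (@RGenCInfty.G R)).
  exact: RGenCInfty.measurableE.
(* By monotonicity the superlevel sets of [f] in [J] are intervals. *)
move=> /= _ [_] [r] -> <-; apply: is_interval_measurable.
move=> s t [/= Js _] [/= Jt ft] u /andP[su ut].
have Ju : u \in J by apply: (interval_is_interval Js Jt); rewrite su.
split; first exact: Ju.
by move: ft; rewrite /= !in_itv /= !andbT => ft; rewrite (le_trans ft)// f_ni.
Qed.

(** On []s_k / 2, s_k]], of length [s_k / 2], [f] is at least [f (s_k)], so each term is at most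
    twice the integral there. The separation hypothesis makes these intervals disjoint for
    increasing and decreasing samples alike. *)
Lemma dyadic_sum_lty (R : realType) (J : interval R) (f : R -> R) (s : nat -> R) :
  {in J &, {homo f : s t /~ s <= t}} -> {in J, forall t, 0 <= f t} ->
  (\int[lebesgue_measure]_(t in [set` J]) (f t)%:E < +oo)%E ->
  (forall k, 0 < s k) ->
  (forall k t, s k / 2 < t <= s k -> t \in J) ->
  (forall i j, i != j -> 2 * s i <= s j \/ 2 * s j <= s i) ->
  (\sum_(0 <= k <oo) (s k * f (s k))%:E < +oo)%E.
Proof.
move=> f_ni f0 fJ s0 sJ s_sep.
pose I k := [set` `]s k / 2, s k]].
have mf : measurable_fun [set` J] (fun t => (f t)%:E).
  by apply/measurable_EFinP; exact: nonincreasing_measurable_itv.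
have mI k : measurable (I k : set (measurableTypeR R)) by exact: measurable_itv.
have IJ k : I k `<=` [set` J] by move=> t; rewrite /I /= in_itv /=; exact: sJ.
have sk k : s k \in J by apply: (sJ k); rewrite lexx andbT ltr_pdivrMr//; have := s0 k; lra.
have sfI k : ((s k * f (s k))%:E <=
    2%:E * \int[lebesgue_measure]_(t in I k) (f t)%:E)%E.
  have -> : (s k * f (s k))%:E = (2%:E *
      \int[lebesgue_measure]_(t in I k) (cst (f (s k))%:E t))%E.
    rewrite (integral_cst _ (mI k)) /I /= lebesgue_measure_itv/= lte_fin ifT; last first.
      by have := s0 k; lra.
    by rewrite -EFinB -!EFinM; congr EFin; field.
  apply: lee_wpmul2l => //; apply: ge0_le_integral => //.
  - by move=> t _; rewrite lee_fin f0.
  - by apply: measurable_funS mf.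
  - move=> t It; have Jt := IJ _ _ It; have Jk := sk k; rewrite lee_fin; apply: f_ni => //.
    by move: It; rewrite /I /= in_itv /= => /andP[].
have tI : trivIset setT I.
  apply/trivIsetP => i j _ _ ij; rewrite -subset0 => t [].
  rewrite /I /= !in_itv /= => /andP[i1 i2] /andP[j1 j2].
  by case: (s_sep _ _ ij); clear -i1 i2 j1 j2; lra.
have UJ : \bigcup_k I k `<=` [set` J] by move=> t [k _]; exact: IJ.
apply: le_lt_trans (lee_nneseries _ _) _.
- by move=> k _ _; rewrite lee_fin mulr_ge0 ?f0// ltW.
- by move=> k _; exact: sfI.
rewrite nneseriesZl; last first.
  by move=> k _; apply: integral_ge0 => t /IJ Jt; rewrite lee_fin f0.
rewrite -ge0_integral_bigcup//; last 2 first.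
- by apply: measurable_funS mf.
- by move=> t /UJ Jt; rewrite lee_fin f0.
rewrite lte_mul_pinfty//; apply: le_lt_trans fJ; apply: ge0_subset_integral => //.
by apply: bigcup_measurable => k _; exact: mI.
Qed.

(** * Borel-Cantelli and the upper limit, for both ends of the time axis at once *)

Section Limsup.
Context (R : realType) (M : pmetricType R).
Context (mu : {measure set (borel M) -> \bar R}).
Context (d : measure_display) (Om : measurableType d).
Context (P : one_point_compactification M -> probability Om R).
Context (Ft : R -> set (set Om)).
Context (X : R -> Om -> one_point_compactification M).
Context (X_hunt : hunt_process P Ft X).
Context (N : set M) (N_exceptional : properly_exceptional P X mu N).
Context (p : R -> M -> M -> R) (p_heat_kernel : heat_kernel P X mu N p).
Context (X_conservative : conservative mu N p).
Context (phi : R -> R) (phi_scale : scale_function phi).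
Context (a : R) (b : \bar R) (K : R) (K_gt0 : 0 < K).
Context (tail : forall (t r : R) (x : M),
  a < t -> (t%:E < b)%E -> 0 < r -> ~ N x ->
  (P (Some x) (X t @^-1` far_from x r) <= (K * t / phi r)%:E)%E).
Context (J : interval R) (varphi : R -> R).
Context (varphi_gt0 : {in J, forall t, 0 < varphi t}).
Context (varphi_nd : {in J &, {homo varphi : s t / s <= t}}).
Context (varphi_int :
  (\int[lebesgue_measure]_(t in [set` J]) ((phi (varphi t))^-1)%:E < +oo)%E).
Context (s : nat -> R) (s_gt0 : forall k, 0 < s k).
Context (s_itv : forall k t, s k / 2 < t <= s k -> t \in J).
Context (s_sep : forall i j, i != j -> 2 * s i <= s j \/ 2 * s j <= s i).
Context (s_time : forall k t, 2 * s k <= t <= 4 * s k -> a < t /\ (t%:E < b)%E).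

Lemma scale_nondecreasing (r1 r2 : R) : 0 < r1 -> r1 <= r2 -> phi r1 <= phi r2.
Proof.
move=> r10; rewrite le_eqVlt => /predU1P[->//|r12].
exact/ltW/(scale_increasing phi_scale).
Qed.

Lemma sample_in_itv (k : nat) : s k \in J.
Proof. by apply: (s_itv (k := k)); have := s_gt0 k; lra. Qed.

(** Borel-Cantelli along the samples; upper scaling of [phi] absorbs [e] into a constant. *)
Lemma ae_eventually_not_exceeds (x : M) (e : R) : ~ N x -> 0 < e <= 2 ->
  {ae P (Some x), forall w, exists k0, forall k, (k0 <= k)%N ->
    ~ exceeds X x (e * varphi (s k)) (2 * s k) w}.
Proof.
move=> Nx /andP[e0 e2].
have [phi0 _ [c3 [c4 [d3 [d4 [_ c40 _ _ phig]]]]]] := phi_scale.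
pose f t := (phi (varphi t))^-1.
have fJ0 : {in J, forall t, 0 <= f t}.
  by move=> t Jt; rewrite invr_ge0 ltW// phi0// varphi_gt0.
have f_ni : {in J &, {homo f : s t /~ s <= t}}.
  move=> t u Jt Ju tu; rewrite lef_pV2 ?posrE ?phi0 ?varphi_gt0//.
  by apply: scale_nondecreasing; [exact: varphi_gt0|exact: varphi_nd].
have sum_fin := dyadic_sum_lty f_ni fJ0 varphi_int s_gt0 s_itv s_sep.
pose E k := exceeds X x (e * varphi (s k)) (2 * s k).
have mE k : measurable (E k).
  by apply: (measurable_exceeds X_hunt); rewrite mulr_ge0// ltW.
(* The 8 is the 2 of the maximal inequality times the 4 of the longest time [4 s_k]; the last factor
   compares [phi] at [varphi (s_k)] and at [e varphi (s_k) / 2]. *)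
pose L := 8 * K * (c4 * (2 / e) `^ d4).
have L0 : 0 <= L by rewrite /L !mulr_ge0 ?powR_ge0// ltW.
have PE k : (P (Some x) (E k) <= L%:E * (s k * f (s k))%:E)%E.
  have v0 := varphi_gt0 (sample_in_itv k); have sk0 := s_gt0 k.
  have r0 : 0 < e * varphi (s k) / 2 by rewrite divr_gt0 ?mulr_gt0.
  have phir := phi0 _ r0; have phiv := phi0 _ v0.
  pose q := K * (4 * s k) / phi (e * varphi (s k) / 2).
  apply: (@le_trans _ _ (2 * q)%:E).
    apply: (ottaviani_maximal_inequality X_hunt N_exceptional p_heat_kernel X_conservative
      (t := 2 * s k) (r := e * varphi (s k)) (q := q) (x := x)) => //.
    - by rewrite mulr_gt0.
    - by rewrite mulr_gt0.
    - by rewrite divr_ge0 ?mulr_ge0// ltW.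
    move=> t y t_itv Ny.
    have [t_a t_b] : a < t /\ (t%:E < b)%E by apply: (s_time (k := k)); lra.
    apply: (le_trans (tail t_a t_b r0 Ny)).
    rewrite lee_fin ler_pM2r ?invr_gt0// ler_pM2l//; lra.
  (* Here [e <= 2] puts the two radii in the order that upper scaling requires. *)
  have rv : e * varphi (s k) / 2 <= varphi (s k).
    by rewrite ler_pdivrMr// mulrC ler_pM2l.
  have := (phig _ _ r0 rv).2.
  rewrite (_ : varphi (s k) / _ = 2 / e); last by field; rewrite !gt_eqF.
  rewrite ler_pdivrMr// => phile; rewrite -EFinM lee_fin /q /L /f.
  rewrite (_ : 2 * _ = 8 * K * s k * (phi (e * varphi (s k) / 2))^-1); last by ring.
  rewrite (_ : _ * (s k / _) = 8 * K * s k *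
    (c4 * (2 / e) `^ d4 / phi (varphi (s k)))); last by ring.
  by rewrite ler_pM2l ?mulr_gt0// ler_pdivlMr// mulrC ler_pdivrMr.
have E_null : P (Some x) (lim_sup_set E) = 0%E.
  apply: lim_sup_set_cvg0 => //.
  apply: le_lt_trans (lee_nneseries _ _) _.
  - by move=> k _ _; exact: measure_ge0.
  - by move=> k _; exact: PE.
  rewrite nneseriesZl; last by move=> k _; rewrite lee_fin mulr_ge0 ?fJ0 ?sample_in_itv// ltW.
  by rewrite lte_mul_pinfty.
exists (lim_sup_set E); split=> //.
  by apply: bigcap_measurable => // k _; apply: bigcup_measurable.
move=> w /= nw k0 _; apply: contrapT => nE; apply: nw; exists k0 => k k0k Ek.
by apply: nE; exists k.
Qed.

Context (G : set_system R) {G_filter : ProperFilter G}.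
Context (G_samples : forall k0, G [set t | t \in J /\
  exists2 k, (k0 <= k)%N & s k <= t <= 2 * s k]).

(** [G] stands for either limit, and [G_samples] places [t] in a window [[s_k, 2 s_k]] with [k] as
    large as desired. The null sets for [e = 1 / (i + 1)] are countably many. *)
Lemma limsup_displacement (x : M) : ~ N x ->
  {ae P (Some x), forall w,
    limf_esup (fun t => sup_displacement X x t w * ((varphi t)^-1)%:E)%E G = 0%E}.
Proof.
move=> Nx.
have ae_exc : {ae P (Some x), forall w, forall i : nat, exists k0, forall k,
    (k0 <= k)%N -> ~ exceeds X x (i.+1%:R^-1 * varphi (s k)) (2 * s k) w}.
  apply: ae_foralln => i; apply: ae_eventually_not_exceeds => //.
  rewrite invr_gt0 ltr0Sn /= (@le_trans _ _ 1) ?ler1n//.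
  by rewrite invf_le1 ?ler1n ?ltr0Sn.
apply: filterS2 (stays_in_regular_points X_hunt N_exceptional p_heat_kernel
  X_conservative Nx) ae_exc => w Xw Ew.
(* Nonnegativity: the supremum includes time 0, and every set of [G] meets a window, where
   [varphi > 0]. *)
apply/eqP; rewrite eq_le; apply/andP; split; last first.
  apply: le_ereal_inf_tmp => _ [A GA <-].
  have [t [At [Jt [k _ stk]]]] := filter_ex (filterI GA (G_samples 0)).
  apply: (@le_trans _ _ (sup_displacement X x t w * ((varphi t)^-1)%:E)%E).
    apply: mule_ge0; last by rewrite lee_fin invr_ge0 ltW// varphi_gt0.
    have : (0%R <= Defs.edist (X 0%R w) x)%E.
      by case: (X 0 w) => [y|] /=; [rewrite lee_fin mdist_ge0|exact: leey].
    move=> /le_trans; apply.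
    apply: ereal_sup_ubound; exists 0 => //; split => //.
    by case/andP: stk => skt _; apply: le_trans skt; exact: ltW.
  by apply: ereal_sup_ubound; exists t.
apply/lee_addgt0Pr => e e0; rewrite add0e.
have [i ie] : exists i : nat, i.+1%:R^-1 < e.
  by exists (Num.trunc e^-1); rewrite invf_plt ?posrE// truncnS_gt.
have [k0 Ek] := Ew i.
apply: (@le_trans _ _ (ereal_sup
    ((fun t => sup_displacement X x t w * ((varphi t)^-1)%:E)%E @`
      [set t | t \in J /\ exists2 k, (k0 <= k)%N & s k <= t <= 2 * s k]))).
  by apply: ereal_inf_lbound; eexists; [exact: (G_samples k0)|].
(* In a window, the displacement up to [t] is at most that up to [2 s_k], hence at most
   [varphi (s_k) / (i + 1) <= e varphi (t)]. *)
apply: ge_ereal_sup => _ [t [Jt [k k0k /andP[skt tsk]]] <-].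
have v0 := varphi_gt0 Jt.
rewrite lee_pdivrMr//.
apply: (@le_trans _ _ (i.+1%:R^-1 * varphi (s k))%:E); last first.
  rewrite -EFinM lee_fin ler_pM//.
  - by rewrite ltW// varphi_gt0// sample_in_itv.
  - exact: ltW.
  - by apply: varphi_nd => //; exact: sample_in_itv.
apply: (@le_trans _ _ (sup_displacement X x (2 * s k) w)).
  apply: ge_ereal_sup => _ [u /= [u0 ut] <-]; apply: ereal_sup_ubound.
  by exists u => //; split=> //; exact: le_trans tsk.
apply: (sup_displacement_le X_hunt).
- by rewrite mulr_gt0.
- by move=> u /Xw [y ->].
- exact: Ek.
Qed.

End Limsup.

(** * Dyadic samples near 0 and near infinity *)

Lemma pow2_separated (R : realType) (i j : nat) : (i < j)%N ->
  2 * 2 ^+ i <= 2 ^+ j :> R.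
Proof. by move=> ij; rewrite -exprS ler_eXn2l// ltr1n. Qed.

Theorem theorem3p1 (R : realType) (M : pmetricType R)
  (M_locally_compact : locally_compact [set: M])
  (M_separable : separable M)
  (M_connected : connected [set: M])
  (M_balls : forall (x : M) (r : R), precompact (ball x r))
  (mu : {measure set (borel M) -> \bar R})
  (mu_radon : radon_on [set: M] mu)
  (mu_full_support : full_support mu)
  (V : R -> R) (V_volume : volume_function V)
  (mu_volume : volume_regular mu V)
  (F : set (M -> R)) (E : (M -> R) -> (M -> R) -> R)
  (E_dirichlet : dirichlet_form mu F E)
  (E_regular : regular_form mu F E)
  (n : {measure set (borel (M * M)%type) -> \bar R})
  (E_pure_jump : pure_jump F E n)
  (d : measure_display) (Om : measurableType d)
  (P : one_point_compactification M -> probability Om R)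
  (Ft : R -> set (set Om))
  (X : R -> Om -> one_point_compactification M)
  (X_hunt : hunt_process P Ft X)
  (X_associated : associated_process P X mu F E)
  (N : set M) (N_exceptional : properly_exceptional P X mu N)
  (p : R -> M -> M -> R) (p_heat_kernel : heat_kernel P X mu N p)
  (phi : R -> R) (phi_scale : scale_function phi)
  (a : R) (b : \bar R) (a_ge0 : 0 <= a) (a_lt_b : (a%:E < b)%E)
  (C : R) (C_gt0 : 0 < C)
  (* no bound is required at y = x, where the right-hand side is +oo *)
  (p_upper_bound : forall (t : R) (x : M), a < t -> (t%:E < b)%E -> ~ N x ->
    {ae mu, forall y, x != y ->
      p t x y <= C * t / (V (mdist x y) * phi (mdist x y))})
  (X_conservative : conservative mu N p) :
  (a = 0 -> forall varphi : R -> R,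
    (forall t : R, 0 < t < 1 -> 0 < varphi t) ->
    (forall s t : R, 0 < s -> s <= t -> t < 1 -> varphi s <= varphi t) ->
    (\int[lebesgue_measure]_(t in `]0%R, 1%R[) ((phi (varphi t))^-1)%:E < +oo)%E ->
    forall x, ~ N x -> {ae P (Some x), forall w,
      limf_esup
        (fun t : R => sup_displacement X x t w * ((varphi t)^-1)%:E)%E (0^'+)
      = 0%E}) /\
  (b = +oo%E -> forall varphi : R -> R,
    (forall t : R, 1 < t -> 0 < varphi t) ->
    (forall s t : R, 1 < s -> s <= t -> varphi s <= varphi t) ->
    (\int[lebesgue_measure]_(t in `]1%R, +oo[) ((phi (varphi t))^-1)%:E < +oo)%E ->
    forall x, ~ N x -> {ae P (Some x), forall w,
      limf_esup
        (fun t : R => sup_displacement X x t w * ((varphi t)^-1)%:E)%E +oo%R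
      = 0%E}).
Proof.
have [K K0 tail] := tail_bound V_volume mu_volume X_hunt p_heat_kernel phi_scale
  a_ge0 C_gt0 p_upper_bound.
have pow2_gt0 k : 0 < 2 ^+ k :> R by rewrite exprn_gt0.
have pow2_mono k l : (k <= l)%N -> 2 ^+ k <= 2 ^+ l :> R.
  by move=> kl; rewrite ler_eXn2l// ltr1n.
split=> [a0|b_oo] varphi varphi_gt0 varphi_nd varphi_int x Nx.
- have [e e0 eb] : exists2 e : R, 0 < e & forall t, t <= e -> (t%:E < b)%E.
    move: a_lt_b; rewrite a0; case: (b) => [b'|_|//].
      rewrite lte_fin => b'0; exists (b' / 2); first by rewrite divr_gt0.
      by move=> t tb; rewrite lte_fin; lra.
    by exists 1 => // t _; rewrite ltry.
  (* [4 / e < 2^k1] gives [4 s_k <= e]; the extra 1 in the exponent gives [s_k < 1] even when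
     [k1 = 0]. *)
  have [k1 k1e] := exists_pow2_gt (4 / e).
  pose s k : R := (2 ^+ (k + k1.+1))^-1.
  have s0 k : 0 < s k by rewrite invr_gt0.
  have s1 k : s k < 1.
    by rewrite invf_lt1// exprn_egt1 ?ltr1n// addnS.
  apply: (limsup_displacement X_hunt N_exceptional p_heat_kernel X_conservative
    phi_scale K0 tail (J := `]0, 1[) _ _ varphi_int s0) => //.
  + move=> t u; rewrite !in_itv /= => /andP[t0 _] /andP[_ u1] tu.
    exact: varphi_nd.
  + move=> k t /andP[st ts]; rewrite in_itv /=.
    by have := s0 k; have := s1 k; lra.
  + move=> i j; rewrite neq_ltn => /orP[ij|ij]; [right|left];
      rewrite /s ler_pdivrMr// ler_pdivlMl// mulrC;
      apply: pow2_separated; rewrite ltn_add2r //.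
  + move=> k t /andP[st ts]; split; first by rewrite a0; have := s0 k; lra.
    apply: eb; apply: (le_trans ts).
    rewrite ler_pdivrMr// -ler_pdivrMl// mulrC (le_trans (ltW k1e))//.
    by rewrite pow2_mono// addnS leqW// leq_addl.
  move=> k0; exists (s k0); first exact: s0.
  move=> t; rewrite /ball_ /= sub0r normrN => tsk t0.
  rewrite gtr0_norm// in tsk.
  have t1 : t < 1 by exact: lt_trans (s1 k0).
  split; first by rewrite in_itv /= t0.
  have tV1 : 1 <= t^-1 by rewrite invf_ge1// ltW.
  (* From [2^m <= 1 / t < 2^(m+1)] the sample is [2^-(m+1)], with exponent [m.+1], since it must lie
     below [t]. *)
  have [m /andP[mt tm]] := dyadic_bracket tV1.
  have mk : (k0 + k1.+1 < m.+1)%N.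
    rewrite -(ltr_eXn2l (x := 2 : R)) ?ltr1n//; apply: lt_trans tm.
    by rewrite invf_pgt ?posrE.
  have mE : (k0 + (m.+1 - (k0 + k1.+1)) + k1.+1 = m.+1)%N.
    by rewrite addnAC subnKC// ltnW.
  exists (k0 + (m.+1 - (k0 + k1.+1)))%N; first exact: leq_addr.
  rewrite /s mE.
  rewrite invf_ple ?posrE// (ltW tm) /= exprS invfM mulVKf//.
  by rewrite invf_pge ?posrE.
(* [a < 2^k1] places all times past [a]; the extra 1 in the exponent gives [s_k / 2 >= 1], so that
   []s_k / 2, s_k]] lies in []1, +oo[]. *)
- have [k1 ak1] := exists_pow2_gt a.
  pose s k : R := 2 ^+ (k + k1.+1).
  have s_ge2 k : 2 <= s k.
    by rewrite -[leLHS]expr1 pow2_mono// addnS.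
  have as_ k : a < s k.
    by apply: (lt_le_trans ak1); rewrite pow2_mono// addnS leqW// leq_addl.
  have s0 k : 0 < s k by exact: pow2_gt0.
  apply: (limsup_displacement X_hunt N_exceptional p_heat_kernel X_conservative
    phi_scale K0 tail (J := `]1, +oo[) _ _ varphi_int s0) => //.
  + by move=> t; rewrite in_itv /= andbT; exact: varphi_gt0.
  + move=> t u; rewrite !in_itv /= !andbT => t1 _; exact: varphi_nd.
  + move=> k t /andP[st _]; rewrite in_itv /= andbT.
    by have := s_ge2 k; lra.
  + move=> i j; rewrite neq_ltn => /orP[ij|ij]; [left|right];
      apply: pow2_separated; by rewrite ltn_add2r.
  + move=> k t /andP[st _]; rewrite b_oo ltry; split=> //.
    by have := as_ k; have := s_ge2 k; lra.
  move=> k0; exists (s k0); split; first exact: num_real.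
  move=> t /ltW st.
  have t2 : 2 <= t by exact: le_trans (s_ge2 k0) st.
  split; first by rewrite in_itv /= andbT (lt_le_trans _ t2)// ltr1n.
  have t1 : 1 <= t by lra.
  (* Here the sample below [t] is [2^m] itself. *)
  have [m /andP[mt tm]] := dyadic_bracket t1.
  have mk : (k0 + k1.+1 < m.+1)%N.
    by rewrite -(ltr_eXn2l (x := 2 : R)) ?ltr1n//; apply: le_lt_trans tm.
  have mE : (k0 + (m - (k0 + k1.+1)) + k1.+1 = m)%N by rewrite addnAC subnKC.
  exists (k0 + (m - (k0 + k1.+1)))%N; first exact: leq_addr.
  rewrite /s mE.
  by rewrite mt -exprS ltW.
Qed.
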